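(* Let $z\neq 1$ be a positive braid with main generator $\sigma_m$. Then $$c(z) = h_m(z) - 1 .$$ In particular, for all $n \ge 2$ and $d \ge 0$, $$c(\Delta_n^d) = h_{n-1}(\Delta_n^d) - 1 .$$
   Context: Braids. $B_n$ ($n\ge1$) is the braid group with generators $\sigma_1,\dots,\sigma_{n-1}$ and relations $\sigma_i\sigma_j=\sigma_j\sigma_i$ for $|i-j|\ge2$, $\sigma_i\sigma_j\sigma_i=\sigma_j\sigma_i\sigma_j$ for $|i-j|=1$; $B_\infty$ is the direct limit of the $B_n$ (generators $\sigma_i$, $i\ge1$). $B_n^+$, $B_\infty^+$ are the monoids with the same presentations; they embed in the groups and their elements are called positive braids. For positive braids, $x\preccurlyeq y$ means $y=xt$ for some positive braid $t$, and $\mathrm{Div}(y)=\{x\in B_\infty^+ : x\preccurlyeq y\}$ (a finite set). $\Delta_1=1$ and $\Delta_n=\sigma_1\sigma_2\cdots\sigma_{n-1}\Delta_{n-1}$. Ordering. A braid word is a word in the letters $\sigma_i^{\pm1}$; $[w]$ denotes the braid represented by $w$. The main generator of a nonempty braid word is $\sigma_m$ where $m$ is the largest index such that $\sigma_m$ or $\sigma_m^{-1}$ occurs; the word is $\sigma$-positive if its main generator $\sigma_m$ occurs but $\sigma_m^{-1}$ does not. For braids $x,y$, $x<y$ means that $x^{-1}y$ has a $\sigma$-positive expression; it is known that $<$ is a strict linear order on $B_\infty$, and that the main generator of a $\sigma$-positive expression of a given braid does not depend on the expression. The main generator of a positive braid $z\ne1$ is the main generator of any positive word representing it. Complexity. $\Gamma(z)$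 is the graph with vertex set $\mathrm{Div}(z)$ and a $\sigma_i$-labelled edge from $x$ to $x\sigma_i$ whenever both lie in $\mathrm{Div}(z)$. A braid word $w$ is drawn in $\Gamma(z)$ from a vertex $x$ if, for every prefix $v\sigma_i$ (resp. $v\sigma_i^{-1}$) of $w$, there is a $\sigma_i$-labelled edge of $\Gamma(z)$ starting from (resp. ending at) $x[v]$; equivalently, $x[v]$ belongs to $\mathrm{Div}(z)$ for every prefix $v$ of $w$. For a positive braid $z\neq1$ with main generator $\sigma_m$, the complexity $c(z)$ is the maximal number of letters $\sigma_m$ in a $\sigma$-positive word drawn in $\Gamma(z)$ (from some vertex). By convention $c(1)=0$. Heights. For $r\ge1$, $x<_r y$ (one also says $(x,y)$ is an $r$-jump) means that $x^{-1}y$ has a $\sigma$-positive expression whose main generator is $\sigma_m$ with $m\ge r$. The $r$-height $h_r(z)$ is the maximal length (number of elements) of a $<_r$-chain contained in $\mathrm{Div}(z)$. *)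

(* Defs.v *)
From HB Require Import structures.
From mathcomp Require Import all_boot.
From mathcomp Require Import ssrint zify.
From mathcomp Require Import boolp classical_sets.

Set Implicit Arguments.
Unset Strict Implicit.
Unset Printing Implicit Defensive.

Local Open Scope quotient_scope.
Local Open Scope group_scope.
Local Open Scope nat_scope.

Definition is_max (A : set nat) (k : nat) : Prop :=
  A k /\ (forall j, A j -> j <= k).

(* The monoid presented by generators A and relations R, as a quotient of the
   free monoid seq A. *)
Section Presented.
Context {A : choiceType}.
Variable R : seq A -> seq A -> Prop.

Inductive word_congr : seq A -> seq A -> Prop :=
| word_congr_rel (a u v b : seq A) of R u v :
    word_congr (a ++ u ++ b) (a ++ v ++ b)
| word_congr_refl (u : seq A) : word_congr u u
| word_congr_sym (u v : seq A) of word_congr u v : word_congr v u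
| word_congr_trans (u v w : seq A) of word_congr u v & word_congr v w :
    word_congr u w.

Lemma word_congr_cat u u' v v' :
  word_congr u u' -> word_congr v v' -> word_congr (u ++ v) (u' ++ v').
Proof.
move=> uu' vv'; apply: (@word_congr_trans _ (u' ++ v)).
  elim: uu' => {u u'} [a u u' b r|u|u u' _|u u' u'' _ h _ h'].
  - by rewrite -!catA; apply: word_congr_rel.
  - exact: word_congr_refl.
  - exact: word_congr_sym.
  - exact: word_congr_trans h h'.
elim: vv' => {v v'} [a v v' b r|v|v v' _|v v' v'' _ h _ h'].
- by rewrite !(catA u'); apply: word_congr_rel.
- exact: word_congr_refl.
- exact: word_congr_sym.
- exact: word_congr_trans h h'.
Qed.

Definition word_congrb : rel (seq A) := fun u v => `[< word_congr u v >].

Lemma word_congrb_refl : reflexive word_congrb.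
Proof. by move=> u; apply/asboolP/word_congr_refl. Qed.

Lemma word_congrb_sym : symmetric word_congrb.
Proof. by move=> u v; apply/asboolP/asboolP; apply: word_congr_sym. Qed.

Lemma word_congrb_trans : transitive word_congrb.
Proof.
by move=> v u w /asboolP uv /asboolP vw; apply/asboolP/(word_congr_trans uv vw).
Qed.

Canonical word_congr_equiv :=
  EquivRel word_congrb word_congrb_refl word_congrb_sym word_congrb_trans.

Definition presented := {eq_quot word_congrb}.

HB.instance Definition _ := Choice.on presented.
HB.instance Definition _ := EqQuotient.on presented.

Definition class_of (u : seq A) : presented := \pi_presented u.

Lemma class_of_repr (x : presented) : class_of (repr x) = x.
Proof. exact: reprK. Qed.

Lemma class_ofP u v : class_of u = class_of v <-> word_congr u v.
Proof.
split=> [/eqmodP/asboolP //|uv].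
by apply/eqmodP/asboolP.
Qed.

Lemma repr_congr u : word_congr (repr (class_of u)) u.
Proof. by apply/class_ofP; rewrite class_of_repr. Qed.

Definition presented_mul (x y : presented) : presented :=
  class_of (repr x ++ repr y).

Lemma presented_mulE u v :
  presented_mul (class_of u) (class_of v) = class_of (u ++ v).
Proof. by apply/class_ofP/word_congr_cat; apply: repr_congr. Qed.

Lemma presented_mulA : associative presented_mul.
Proof.
move=> x y z; rewrite -(class_of_repr x) -(class_of_repr y) -(class_of_repr z).
by rewrite !presented_mulE catA.
Qed.

Lemma presented_mul1 : left_id (class_of [::]) presented_mul.
Proof. by move=> x; rewrite -(class_of_repr x) presented_mulE. Qed.

Lemma presented_mulr1 : right_id (class_of [::]) presented_mul.
Proof. by move=> x; rewrite -(class_of_repr x) presented_mulE cats0. Qed.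

HB.instance Definition _ := isMonoid.Build presented
  presented_mulA presented_mul1 presented_mulr1.

End Presented.

(* The letter k : nat stands for sigma_(k+1), so that the generators are
   sigma_1, sigma_2, ...; m below always denotes the index of sigma_m. *)
Inductive braid_rel : seq nat -> seq nat -> Prop :=
| braid_far (i j : nat) of 2 <= `|i - j| : braid_rel [:: i; j] [:: j; i]
| braid_near (i j : nat) of `|i - j| = 1 :
    braid_rel [:: i; j; i] [:: j; i; j].

(* The signed letter (k, true) stands for sigma_(k+1), and (k, false) for its
   inverse. *)
Definition letter := (nat * bool)%type.

Definition pos_word (w : seq nat) : seq letter := [seq (k, true) | k <- w].

Inductive braid_group_rel : seq letter -> seq letter -> Prop :=
| braid_group_pos (u v : seq nat) of braid_rel u v :
    braid_group_rel (pos_word u) (pos_word v)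
| braid_group_cancel (k : nat) (b : bool) :
    braid_group_rel [:: (k, b); (k, ~~ b)] [::].

(* The monoid B_oo^+ and the group B_oo.  The direct limit of the groups B_n
   is the group presented by all the generators and all the relations. *)
Definition pbraid := presented braid_rel.
Definition braid := presented braid_group_rel.

HB.instance Definition _ := Monoid.on pbraid.
HB.instance Definition _ := EqQuotient.on pbraid.
HB.instance Definition _ := Monoid.on braid.
HB.instance Definition _ := EqQuotient.on braid.

Definition flip (a : letter) : letter := (a.1, ~~ a.2).
Definition inv_word (w : seq letter) : seq letter := rev (map flip w).

Definition braid_inv (x : braid) : braid := class_of _ (inv_word (repr x)).

Lemma flipK : involutive flip.
Proof. by case=> k b; rewrite /flip /= negbK. Qed.

Lemma inv_wordK : involutive inv_word.
Proof. by move=> w; rewrite /inv_word map_rev revK (mapK flipK). Qed.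

Lemma inv_word_mulr w : word_congr braid_group_rel (w ++ inv_word w) [::].
Proof.
elim: w => [|[k b] w IHw]; first exact: word_congr_refl.
rewrite /inv_word /= rev_cons -cats1 catA -/(inv_word w).
apply: (@word_congr_trans _ _ _ ([:: (k, b)] ++ [:: flip (k, b)])).
  apply: (@word_congr_cat _ _ [:: (k, b)]); first exact: word_congr_refl.
  by apply: (word_congr_cat IHw); apply: word_congr_refl.
exact: (word_congr_rel [::] [::] (braid_group_cancel k b)).
Qed.

Lemma braid_mulrV : right_inverse (1%g : braid) braid_inv *%g.
Proof.
move=> x; rewrite -[X in (X * _)%g]class_of_repr.
by rewrite [LHS]presented_mulE; apply/class_ofP/inv_word_mulr.
Qed.

Lemma braid_mulVr : left_inverse (1%g : braid) braid_inv *%g.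
Proof.
move=> x; rewrite -[X in (_ * X)%g]class_of_repr [LHS]presented_mulE.
rewrite -[in X in _ ++ X](inv_wordK (repr x)).
by apply/class_ofP/inv_word_mulr.
Qed.

HB.instance Definition _ := hasInv.Build braid braid_inv.
HB.instance Definition _ := Monoid_isGroup.Build braid braid_mulVr braid_mulrV.

(* The braid [w] represented by a word, and its analogue for positive words. *)
Definition braid_of (w : seq letter) : braid := class_of _ w.
Definition pbraid_of (w : seq nat) : pbraid := class_of _ w.

(* The canonical morphism B_oo^+ -> B_oo. *)
Definition emb (x : pbraid) : braid := braid_of (pos_word (repr x)).

Lemma pos_word_congr u v : word_congr braid_rel u v ->
  word_congr braid_group_rel (pos_word u) (pos_word v).
Proof.
elim=> {u v} [a u v b r|u|u v _|u v w _ h _ h'].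
- rewrite /pos_word !map_cat.
  by apply: word_congr_rel; apply: braid_group_pos.
- exact: word_congr_refl.
- exact: word_congr_sym.
- exact: word_congr_trans h h'.
Qed.

Lemma emb_of w : emb (pbraid_of w) = braid_of (pos_word w).
Proof. exact/class_ofP/pos_word_congr/repr_congr. Qed.

Lemma emb_monoid_morphism : monoid_morphism emb.
Proof.
split=> [|x y]; first exact: (emb_of [::]).
rewrite -(class_of_repr x) -(class_of_repr y) [(_ * _)%g]presented_mulE.
by rewrite !emb_of [RHS]presented_mulE /pos_word map_cat.
Qed.

HB.instance Definition _ := isUMagmaMorphism.Build pbraid braid emb
  emb_monoid_morphism.

(* Main generators: a word has main generator sigma_m, where m is the value
   below; this value is 0 for the empty word. *)
Definition pword_main (w : seq nat) : nat := \max_(k <- w) k.+1.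
Definition word_main (w : seq letter) : nat := \max_(a <- w) a.1.+1.

Definition main (z : pbraid) : nat := pword_main (repr z).

Lemma pword_main_congr u v :
  word_congr braid_rel u v -> pword_main u = pword_main v.
Proof.
elim=> {u v} [a u v b r|u|u v _|u v w _ -> _ ->] //.
rewrite /pword_main !big_cat /=; congr (maxn _ (maxn _ _)).
by case: r => i j _; rewrite !big_cons big_nil; lia.
Qed.

Lemma main_of w : main (pbraid_of w) = pword_main w.
Proof. exact/pword_main_congr/repr_congr. Qed.

Definition sigma_positive (w : seq letter) : bool :=
  has (fun a => (a.1.+1 == word_main w) && a.2) w
  && ~~ has (fun a => (a.1.+1 == word_main w) && ~~ a.2) w.

(* jump r x y is x <_r y; the order < itself is jump 1. *)
Definition jump (r : nat) (x y : pbraid) : Prop :=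
  exists w : seq letter,
    [/\ sigma_positive w, r <= word_main w
      & braid_of w = ((emb x)^-1 * emb y)%g].

Definition divides (x y : pbraid) : Prop := exists t : pbraid, y = (x * t)%g.

Definition Div (z : pbraid) : set pbraid := [set x | divides x z].

Definition psigma (k : nat) : pbraid := pbraid_of [:: k].

(* The edges of Gamma(z) from x to y labelled by the letter k. *)
Definition edge (z : pbraid) (k : nat) (x y : pbraid) : Prop :=
  [/\ Div z x, Div z y & y = (x * psigma k)%g].

Definition drawn (z x : pbraid) (w : seq letter) : Prop :=
  Div z x /\
  forall (v t : seq letter) (k : nat) (b : bool), w = v ++ (k, b) :: t ->
    exists p q : pbraid, edge z k p q /\
      emb (if b then p else q) = (emb x * braid_of v)%g.

(* The values n such that some sigma-positive word with exactly n letters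
   sigma_m is drawn in Gamma(z). *)
Definition drawn_counts (m : nat) (z : pbraid) : set nat :=
  [set n | exists (x : pbraid) (w : seq letter),
    [/\ sigma_positive w, drawn z x w
      & n = count (fun a : letter => (a.1.+1 == m) && a.2) w]].

Definition is_complexity (z : pbraid) (c : nat) : Prop :=
  if z == 1%g then c = 0 else is_max (drawn_counts (main z) z) c.

(* Comparing consecutive elements is enough, since <_r is transitive. *)
Definition chain_lengths (r : nat) (z : pbraid) : set nat :=
  [set n | exists s : seq pbraid,
    [/\ forall x, x \in s -> Div z x,
        sorted (fun x y => `[< jump r x y >]) s & n = size s]].

Definition is_height (r : nat) (z : pbraid) (h : nat) : Prop :=
  is_max (chain_lengths r z) h.

Fixpoint Delta (n : nat) : pbraid :=
  if n is k.+1 then (\prod_(i < k) psigma i * Delta k)%g else 1%g.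

(* Main.v *)
From HB Require Import structures.
Require Import Defs.
From mathcomp Require Import all_boot all_order all_algebra.
From mathcomp Require Import zify ring lra boolp classical_sets.

(* A sigma-positive word drawn in Gamma(z) visits, after each of its letters
   sigma_m, the elements of a <_m-chain, whence c(z) <= h_m(z) - 1.  For the
   converse, every <_m-step between two vertices x, y of Gamma(z) must be
   realised by a sigma-positive path.  The vertex z is reached from both x and
   y by positive paths, so there are peaks q such that x and y are joined to q
   by paths without sigma_m^{-1}.  If both paths contain sigma_m, removing their
   last letters sigma_m and performing a handle reduction (inductively, the
   part between these letters may be taken consistent in sigma_(m-1)) yields a
   <_m-smaller peak.  So at a minimal peak one of the paths avoids sigma_m, and
   x and y are joined by a path in which sigma_m occurs with one sign only.

   Keeping reduced paths inside Div(z) rests on Garside's theory (cancellation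
   and lcms of generators).  That sigma-positive words are not trivial follows
   from an action of the braid group by positive rational maps under which
   sigma_m strictly decreases a coordinate that the sigma_i, i < m, fix. *)

Set Implicit Arguments.
Unset Strict Implicit.
Unset Printing Implicit Defensive.

Import Order.TTheory GRing.Theory Num.Theory.
Local Open Scope group_scope.
Local Open Scope nat_scope.

(** * Garside theory *)

Definition len (x : pbraid) : nat := size (repr x).

Lemma word_congr_size u v : word_congr braid_rel u v -> size u = size v.
Proof.
by elim=> {u v} [a u v b r|//|//|u v w _ -> _ ->] //; rewrite !size_cat; case: r.
Qed.

Lemma len_of w : len (pbraid_of w) = size w.
Proof. exact/word_congr_size/repr_congr. Qed.

Lemma pbraid_of_cat u v : pbraid_of (u ++ v) = (pbraid_of u * pbraid_of v)%g.
Proof. by rewrite [RHS]presented_mulE. Qed.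

Lemma pbraid_of_cons k w : pbraid_of (k :: w) = (psigma k * pbraid_of w)%g.
Proof. exact: (pbraid_of_cat [:: k]). Qed.

Lemma pbraid_of_repr (x : pbraid) : pbraid_of (repr x) = x.
Proof. exact: class_of_repr. Qed.

Lemma lenM x y : len (x * y)%g = len x + len y.
Proof.
rewrite -(pbraid_of_repr x) -(pbraid_of_repr y) -pbraid_of_cat.
by rewrite !len_of size_cat.
Qed.

Lemma len_sigma k : len (psigma k) = 1.
Proof. exact: len_of. Qed.

Lemma mainM x y : main (x * y)%g = maxn (main x) (main y).
Proof.
rewrite -(pbraid_of_repr x) -(pbraid_of_repr y) -pbraid_of_cat !main_of.
by rewrite /pword_main big_cat.
Qed.

Lemma main_sigma k : main (psigma k) = k.+1.
Proof. by rewrite main_of /pword_main big_seq1. Qed.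

Lemma main1 : main 1%g = 0.
Proof. by rewrite [LHS](main_of [::]) /pword_main big_nil. Qed.

Lemma len1 : len 1%g = 0.
Proof. exact: (len_of [::]). Qed.

Lemma len_eq0 x : len x = 0 -> x = 1%g.
Proof. by rewrite -{2}(pbraid_of_repr x) => /size0nil ->. Qed.

Lemma pbraid_ind (P : pbraid -> Prop) :
  P 1%g -> (forall k x, P x -> P (psigma k * x)%g) -> forall x, P x.
Proof.
move=> P1 PS x; rewrite -(pbraid_of_repr x).
by elim: (repr x) => [//|k w IH]; rewrite pbraid_of_cons; apply: PS.
Qed.

Lemma pbraid_case (x : pbraid) : x = 1%g \/ exists k y, x = (psigma k * y)%g.
Proof. by elim/pbraid_ind: x => [|k x _]; [left|right; exists k, x]. Qed.

(** * Common multiples of two generators *)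

Definition far i j := (i + 2 <= j) || (j + 2 <= i).
Definition near i j := (i == j + 1) || (j == i + 1).

Lemma farC i j : far i j = far j i. Proof. by rewrite /far orbC. Qed.
Lemma nearC i j : near i j = near j i. Proof. by rewrite /near orbC. Qed.

Lemma sigma_far i j : far i j ->
  (psigma i * psigma j = psigma j * psigma i)%g.
Proof.
move=> h; rewrite -!pbraid_of_cat; apply/class_ofP.
have r : braid_rel [:: i; j] [:: j; i].
  by apply: braid_far; move: h; rewrite /far; lia.
exact: (word_congr_rel [::] [::] r).
Qed.

Lemma sigma_near i j : near i j ->
  (psigma i * (psigma j * psigma i) = psigma j * (psigma i * psigma j))%g.
Proof.
move=> h; rewrite /psigma -!pbraid_of_cat; apply/class_ofP.
have r : braid_rel [:: i; j; i] [:: j; i; j].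
  by apply: braid_near; move: h; rewrite /near; lia.
exact: (word_congr_rel [::] [::] r).
Qed.

Lemma sigma_far_mul i j x : far i j ->
  (psigma i * (psigma j * x) = psigma j * (psigma i * x))%g.
Proof. by move=> h; rewrite !mulgA (sigma_far h). Qed.

Lemma sigma_near_mul i j x : near i j ->
  (psigma i * (psigma j * (psigma i * x)) =
   psigma j * (psigma i * (psigma j * x)))%g.
Proof. by move=> h; have:= sigma_near h; rewrite !mulgA => ->. Qed.

(* The right lcm of [psigma i] and [psigma j] is [psigma i * compl i j]. *)
Definition compl i j : pbraid :=
  if i == j then 1%g else if far i j then psigma j else (psigma j * psigma i)%g.

Variant letters_spec i j : Prop :=
| Same of i = j
| Far of i != j & far i j & ~~ near i j
| Near of i != j & ~~ far i j & near i j.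

Lemma lettersP i j : letters_spec i j.
Proof.
case: (i =P j) => [->|ij]; first by constructor 1.
case f: (far i j); first by constructor 2; move: f ij; rewrite /far /near //; lia.
by constructor 3; move: f ij; rewrite /far /near //; lia.
Qed.

Lemma complii i : compl i i = 1%g. Proof. by rewrite /compl eqxx. Qed.
Lemma compl_far i j : far i j -> compl i j = psigma j.
Proof.
by rewrite /compl => f; rewrite f; case: eqP f => // ->; rewrite /far; lia.
Qed.
Lemma compl_near i j : near i j -> compl i j = (psigma j * psigma i)%g.
Proof.
rewrite /compl /near /far => n; case: eqP => [ij|_]; first lia.
by case: ifP => // f; exfalso; move: n f; lia.
Qed.

Lemma complP i j : (psigma i * compl i j = psigma j * compl j i)%g.
Proof.
case: (lettersP i j) => [->//|_ f _|_ _ n].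
  by rewrite !compl_far ?(farC j) // sigma_far.
by rewrite !compl_near ?(nearC j) // sigma_near.
Qed.

(** By [complP] this makes [psigma i * x] and [psigma j * y] the same multiple of the lcm, with
    cofactor [t]. *)
Definition lcm_multiple i x j y :=
  exists t, x = (compl i j * t)%g /\ y = (compl j i * t)%g.

Lemma lcm_multipleC i x j y : lcm_multiple i x j y -> lcm_multiple j y i x.
Proof. by case=> t []; exists t. Qed.

Section LcmMultipleTrans.
Variable L : nat.
Hypothesis IH : forall i x j y, len x < L ->
  (psigma i * x = psigma j * y)%g -> lcm_multiple i x j y.

(** The mixed case of transitivity, isolated because the opposite order of [far] and [near] follows
    from it by [lcm_multipleC]. *)
Lemma lcm_multiple_trans_far_near i j k x w y : far i k -> near k j -> len w <= L ->
  lcm_multiple i x k w -> lcm_multiple k w j y -> lcm_multiple i x j y.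
Proof.
move=> fik nkj lw.
rewrite /lcm_multiple (compl_far fik) (compl_far (etrans (farC _ _) fik)).
rewrite (compl_near nkj) (compl_near (etrans (nearC _ _) nkj)).
case=> t [-> wt] [s [ws ->]]; move: lw; rewrite wt lenM len_sigma => lt.
have {ws} := ws; rewrite wt -mulgA => /(IH lt).
case: (lettersP i j) => [ij|ij fij _|ij _ nij].
- by exfalso; move: fik nkj; rewrite ij /far /near; lia.
- case=> u; rewrite (compl_far fij) (compl_far (etrans (farC _ _) fij)).
  case=> tu; move: lt; rewrite tu lenM len_sigma => lu.
  move=> e; move: (e); have ls : len s < L.
    by have /(congr1 len) := e; rewrite !lenM !len_sigma; lia.
  move/(IH ls)=> [v]; rewrite (compl_far fik) (compl_far (etrans (farC _ _) fik)).
  case=> -> ->; exists (psigma k * (psigma j * v))%g.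
  rewrite -!mulgA; split; first by rewrite sigma_near_mul.
  by rewrite (sigma_far_mul _ (etrans (farC _ _) fij)) [in RHS](sigma_far_mul _ fik).
- case=> u; rewrite (compl_near nij) (compl_near (etrans (nearC _ _) nij)).
  case=> tu; move: lt; rewrite tu !lenM !len_sigma => lu; rewrite -mulgA.
  move=> e; move: (e); have ls : len s < L.
    by have /(congr1 len) := e; rewrite !lenM !len_sigma; lia.
  move/(IH ls)=> [v]; rewrite (compl_far fik) (compl_far (etrans (farC _ _) fik)).
  case=> sv /IH []; first by move/(congr1 len): e; rewrite sv !lenM !len_sigma; lia.
  move=> r; rewrite (compl_near nkj) (compl_near (etrans (nearC _ _) nkj)).
  case=> ur vr; rewrite sv ur vr; exists (psigma k * (psigma j * (psigma i * r)))%g.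
  have [fki njk nji] : [/\ far k i, near j k & near j i].
    by rewrite farC (nearC j) (nearC j).
  rewrite -!mulgA; split.
    rewrite (sigma_far_mul _ fik) (sigma_near_mul _ nkj).
    by rewrite (sigma_near_mul _ nji) (sigma_far_mul _ fki).
  rewrite (sigma_near_mul _ nji) (sigma_far_mul _ fki) (sigma_far_mul r fik).
  by rewrite (sigma_near_mul _ nkj).
Qed.

(** Two factorisations are compared through a third. The lcm property of shorter braids, [IH],
    unrolls the middle term until a common cofactor appears, in each configuration of [i], [j],
    [k]. *)
Lemma lcm_multiple_trans i j k x w y : len w <= L ->
  lcm_multiple i x k w -> lcm_multiple k w j y -> lcm_multiple i x j y.
Proof.
move=> lw; case: (lettersP i k) => [->|_ fik _|_ _ nik].
- by case=> t []; rewrite complii !mul1g => -> ->.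
- case: (lettersP k j) => [->|_ fkj _|_ _ nkj].
  + by move=> q [t []]; rewrite complii !mul1g => wt ->; rewrite -wt.
  + rewrite /lcm_multiple (compl_far fik) (compl_far (etrans (farC _ _) fik)).
    rewrite (compl_far fkj) (compl_far (etrans (farC _ _) fkj)).
    case=> t [-> wt] [s [ws ->]]; move: lw ws; rewrite wt lenM len_sigma => lt.
    move/(IH lt) => [u [-> ->]]; exists (psigma k * u)%g.
    have cl a b : far k a -> far b k ->
        (psigma k * compl a b = compl a b * psigma k)%g.
      move=> fa fb; case: (lettersP a b) => [->|_ f _|_ _ n].
      * by rewrite complii mulg1 mul1g.
      * by rewrite (compl_far f) sigma_far // farC.
      * by rewrite (compl_near n) -mulgA -(sigma_far fa) !mulgA (sigma_far fb).
    by rewrite !mulgA !cl // farC.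
  + exact: lcm_multiple_trans_far_near.
- case: (lettersP k j) => [->|_ fkj _|_ _ nkj].
  + by move=> q [t []]; rewrite complii !mul1g => wt ->; rewrite -wt.
  + move=> /lcm_multipleC q1 /lcm_multipleC q2; apply: lcm_multipleC.
    apply: (lcm_multiple_trans_far_near _ _ lw q2 q1).
      by rewrite farC.
    by rewrite nearC.
  + rewrite /lcm_multiple (compl_near nik) (compl_near (etrans (nearC _ _) nik)).
    rewrite (compl_near nkj) (compl_near (etrans (nearC _ _) nkj)).
    case=> t [-> wt] [s [ws ->]]; move: lw ws; rewrite wt !lenM !len_sigma => lt.
    rewrite -!mulgA => e; have ls : len s < L.
      by have /(congr1 len) := e; rewrite !lenM !len_sigma; lia.
    have lt0 : len t < L by lia.
    have: lcm_multiple i (psigma k * t)%g j (psigma k * s)%g.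
      by apply: IH => //; rewrite lenM len_sigma; lia.
    case: (lettersP i j) => [ij|ij fij _|ij _ nij].
    * rewrite ij => -[u []]; rewrite complii !mul1g => <- e'.
      have [v []] := IH ls e'; rewrite !complii !mul1g => -> ->.
      exists (psigma k * (psigma j * v))%g.
      by rewrite !mul1g.
    * case=> u []; rewrite (compl_far fij) (compl_far (etrans (farC _ _) fij)).
      move=> e1 e2; have [t' [et eu]] := IH lt0 e1; have [s' [es eu']] := IH ls e2.
      have njk : near j k by rewrite nearC.
      have nki : near k i by rewrite nearC.
      move: et eu es eu'; rewrite (compl_near nkj) (compl_near njk).
      rewrite (compl_near nik) (compl_near nki) -!mulgA => et eu es.
      have lu : len (psigma j * t')%g < L.
        by move: lt; rewrite et !lenM !len_sigma; lia.
      rewrite eu => e3; have [v []] := IH lu e3; rewrite complii !mul1g => ev1 ev2.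
      have lt' : len t' < L by move: lu; rewrite lenM len_sigma; lia.
      have e4 : (psigma j * t' = psigma i * s')%g by rewrite ev1 ev2.
      have [r []] := IH lt' e4.
      rewrite (compl_far fij) (compl_far (etrans (farC _ _) fij)) => et' es'.
      rewrite et es et' es'.
      exists (psigma k * (psigma j * (psigma i * (psigma k * r))))%g.
      have fji : far j i by rewrite farC.
      split.
        rewrite (sigma_far_mul _ fij) -(sigma_near_mul _ nki).
        by rewrite (sigma_near_mul _ nkj).
      rewrite (sigma_far_mul (psigma k * (psigma j * r))%g fji).
      rewrite -(sigma_near_mul _ nkj) (sigma_near_mul _ nki).
      by rewrite (sigma_far_mul _ fij).
    * by exfalso; move: nik nkj nij; rewrite /near; lia.
Qed.
End LcmMultipleTrans.

(** Garside's argument: an outer induction on length and an inner one on the derivation of the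
    congruence. A relation applied at the head gives the lcm itself, one applied further right keeps
    the first letter, and transitivity is [lcm_multiple_trans]. *)
Lemma sigma_lcm i x j y : (psigma i * x = psigma j * y)%g -> lcm_multiple i x j y.
Proof.
have [n] := ubnP (len x); elim: n => // n IHn in i x j y *.
move=> lx e.
have {}IHn i' x' j' y' : len x' < len x ->
    (psigma i' * x' = psigma j' * y')%g -> lcm_multiple i' x' j' y'.
  by move=> lx'; apply: IHn; apply: leq_trans lx' _.
(* Fixing the length keeps the outer hypothesis applicable at every intermediate word of the
   derivation. *)
pose P (u v : seq nat) := forall a u' b v', size u = (len x).+1 ->
  u = a :: u' -> v = b :: v' -> lcm_multiple a (pbraid_of u') b (pbraid_of v').
suff PP u v : word_congr braid_rel u v -> P u v.
  move: e lx; rewrite -(pbraid_of_repr x) -(pbraid_of_repr y) -!pbraid_of_cons.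
  by move=> /class_ofP /PP h _; apply: h => //; rewrite /= -len_of.
have multiple_refl a z : lcm_multiple a z a z by exists z; rewrite complii mul1g.
elim=> {u v} [a u v b r|u|u v uv IHuv|u v w uv IHuv vw IHvw] c u' d v' su.
- case: a su => [|a0 a] /= su; last first.
    move=> [<- <-] [<- <-].
    suff -> : pbraid_of (a ++ u ++ b) = pbraid_of (a ++ v ++ b) by [].
    by apply/class_ofP/word_congr_rel.
  case: r su => i' j' ij su [<- <-] [<- <-].
    have f : far i' j' by rewrite /far; lia.
    rewrite !pbraid_of_cons; exists (pbraid_of b).
    by rewrite (compl_far f) (compl_far (etrans (farC _ _) f)).
  have f : near i' j' by rewrite /near; lia.
  rewrite !pbraid_of_cons; exists (pbraid_of b).
  by rewrite (compl_near f) (compl_near (etrans (nearC _ _) f)) -!mulgA.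
- by move=> -> [<- <-].
- move=> ev eu; apply: lcm_multipleC; apply: IHuv eu ev.
  by rewrite (word_congr_size uv).
- move=> eu ew; have sv := word_congr_size uv.
  case ev : v sv => [|k v''] sv; first by rewrite eu in sv.
  apply: (lcm_multiple_trans (k := k) (w := pbraid_of v'') IHn).
  + by rewrite len_of; move: su; rewrite sv /=; lia.
  + exact: IHuv.
  + by apply: IHvw => //; rewrite ev -sv.
Qed.

Lemma sigma_mulI k : injective (fun x : pbraid => psigma k * x)%g.
Proof. by move=> x y /sigma_lcm [t []]; rewrite complii !mul1g => -> ->. Qed.

Lemma pbraid_mulI (a : pbraid) : injective (fun x => a * x)%g.
Proof.
elim/pbraid_ind: a => [|k a IH] x y; first by rewrite !mul1g.
by rewrite -!mulgA => /sigma_mulI /IH.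
Qed.

Lemma main_eq0 (x : pbraid) : main x = 0 -> x = 1%g.
Proof.
by case: (pbraid_case x) => [//|[k [y ->]]]; rewrite mainM main_sigma; lia.
Qed.

Lemma main_compl n i j : i < n -> j < n -> main (compl i j) <= n.
Proof.
move=> hi hj; rewrite /compl; case: ifP => _; first by rewrite main1.
by case: ifP => _; rewrite ?mainM !main_sigma; lia.
Qed.

(** The common multiple is tiled by squares: the elementary one that [sigma_lcm] gives for the first
    letters, then three recursive ones. All sides keep [main] at most [n], because [compl] does. *)
Lemma pbraid_lcm n (a b s t : pbraid) : main a <= n -> main b <= n ->
  (a * s = b * t)%g -> exists p r g,
  [/\ main p <= n, main r <= n, s = (p * g)%g, t = (r * g)%g & (a * p = b * r)%g].
Proof.
have [N] := ubnP (len (a * s)%g); elim: N => // N IH in a b s t *.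
move=> lN ma mb e.
case: (pbraid_case a) => [a1|[i [a' ea]]].
  by exists b, 1%g, t; rewrite -e a1 !mul1g mulg1 main1.
case: (pbraid_case b) => [b1|[j [b' eb]]].
  by exists 1%g, a, s; rewrite e b1 !mul1g mulg1 main1.
move: e ma mb lN; rewrite ea eb !mainM !main_sigma !lenM len_sigma !geq_max.
rewrite -!mulgA => /sigma_lcm [h [e1 e2]] /andP[li ma] /andP[lj mb] lN.
have := congr1 len e1; rewrite !lenM => l1.
have := congr1 len e2; rewrite !lenM => l2.
have := congr1 len (complP i j); rewrite !lenM !len_sigma => l3.
have [||||p1 [r1 [g1 [mp1 mr1 es eh1 e3]]]] := IH a' (compl i j) s h => //.
- by rewrite lenM; lia.
- exact: main_compl.
have [||||p2 [r2 [g2 [mp2 mr2 et eh2 e4]]]] := IH b' (compl j i) t h => //.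
- by rewrite lenM; lia.
- exact: main_compl.
(* The last tile is spanned by [r1] and [r2], which both divide the cofactor [h] of the elementary
   square. *)
have e5 : (r1 * g1 = r2 * g2)%g by rewrite -eh1.
have [|//|//||p3 [r3 [g [mp3 mr3 eg1 eg2 e6]]]] := IH r1 r2 g1 g2 => //.
  by rewrite -eh1; lia.
exists (p1 * p3)%g, (p2 * r3)%g, g; rewrite !mainM !geq_max.
split; rewrite ?mp1 ?mp2 ?mp3 ?mr3 // -?mulgA -?eg1 -?eg2 //.
by rewrite (mulgA a') e3 (mulgA b') e4 -!mulgA e6 !mulgA complP.
Qed.

(** * Word reversal and the right-hand versions *)

Definition mirror (x : pbraid) : pbraid := pbraid_of (rev (repr x)).

Lemma word_congr_rev u v : word_congr braid_rel u v ->
  word_congr braid_rel (rev u) (rev v).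
Proof.
elim=> {u v} [a u v b r|u|u v _|u v w _ h _ h'].
- rewrite !rev_cat -!catA; apply: word_congr_rel.
  by case: r => i j ij; [apply: braid_far; lia|apply: braid_near].
- exact: word_congr_refl.
- exact: word_congr_sym.
- exact: word_congr_trans h h'.
Qed.

Lemma mirror_of w : mirror (pbraid_of w) = pbraid_of (rev w).
Proof. exact/class_ofP/word_congr_rev/repr_congr. Qed.

Lemma mirrorM x y : mirror (x * y)%g = (mirror y * mirror x)%g.
Proof.
rewrite -(pbraid_of_repr x) -(pbraid_of_repr y) -pbraid_of_cat.
by rewrite !mirror_of rev_cat pbraid_of_cat.
Qed.

Lemma mirrorK : involutive mirror.
Proof. by move=> x; rewrite -(pbraid_of_repr x) !mirror_of revK. Qed.

Lemma mirror_sigma k : mirror (psigma k) = psigma k.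
Proof. exact: mirror_of. Qed.

Lemma sigma_rcm i x j y : (x * psigma i = y * psigma j)%g ->
  exists t, x = (t * mirror (compl i j))%g /\ y = (t * mirror (compl j i))%g.
Proof.
move=> /(congr1 mirror); rewrite !mirrorM !mirror_sigma => /sigma_lcm [t [e1 e2]].
by exists (mirror t); rewrite -!mirrorM -e1 -e2 !mirrorK.
Qed.

Lemma sigma_mulIr k : injective (fun x : pbraid => (x * psigma k)%g).
Proof.
move=> x y /= /(congr1 mirror); rewrite !mirrorM => /pbraid_mulI /(congr1 mirror).
by rewrite !mirrorK.
Qed.

(** * Non-triviality of sigma-positive words *)

Ltac positivity := by repeat first [assumption | done
  | apply: addr_gt0 | apply: mulr_gt0 | rewrite invr_gt0].

Ltac nz := by do ?[apply/andP; split]; apply: lt0r_neq0; positivity.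

Section Dynnikov.
Local Open Scope ring_scope.

(* Dynnikov's formulas, with maximum and sum replaced by sum and product;
   [dyn false] is the inverse of [dyn true]. *)
Definition dyn (b : bool) (p q : rat * rat) : (rat * rat) * (rat * rat) :=
  let: ((x1, y1), (x2, y2)) := (p, q) in
  if b then
    let d := x2 * y1 + x1 * (1 + y1) * (1 + y2) in
    ((x1 * (1 + y1) + x2 * y1, x2 * y1 * y2 / d),
     (x1 * x2 * y2 / (x1 * (1 + y2) + x2), d / x2))
  else
    let d := x1 * y1 + x2 * (1 + y1) * (1 + y2) in
    ((x1 * x2 / (x2 * (1 + y1) + x1 * y1), x1 * y1 * y2 / d),
     ((x2 * (1 + y2) + x1) / y2, d / x1)).

Definition pos2 (p : rat * rat) := (0 < p.1) && (0 < p.2).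

Lemma dyn_pos b p q : pos2 p -> pos2 q ->
  pos2 (dyn b p q).1 && pos2 (dyn b p q).2.
Proof.
case: p q => [x1 y1] [x2 y2] /andP[/= h1 h2] /andP[/= h3 h4].
by case: b; rewrite /dyn /pos2 /=; do !(apply/andP; split); positivity.
Qed.

Lemma dynK b p q : pos2 p -> pos2 q ->
  dyn (~~ b) (dyn b p q).1 (dyn b p q).2 = (p, q).
Proof.
case: p q => [x1 y1] [x2 y2] /andP[/= h1 h2] /andP[/= h3 h4].
case: b; rewrite /dyn /=.
  congr ((_, _), (_, _)); field; nz.
congr ((_, _), (_, _)); field; nz.
Qed.

Lemma dyn_braid (p q r : rat * rat) :
  pos2 p -> pos2 q -> pos2 r ->
  let s12 t := let: (u, v, w) := t in ((dyn true u v).1, (dyn true u v).2, w) in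
  let s23 t := let: (u, v, w) := t in (u, (dyn true v w).1, (dyn true v w).2) in
  s12 (s23 (s12 (p, q, r))) = s23 (s12 (s23 (p, q, r))).
Proof.
case: p q r => [x1 y1] [x2 y2] [x3 y3].
move=> /andP[/= h1 h2] /andP[/= h3 h4] /andP[/= h5 h6].
rewrite /dyn; cbv zeta; cbn [fst snd].
congr ((_, _), (_, _), (_,_)).
all: field; nz.
Qed.
End Dynnikov.

(** Clearing the denominator leaves the positive gap [x1 * x2 + x2 * x2]. *)
Lemma dyn_decr (p q : rat * rat) : pos2 p -> pos2 q ->
  ((dyn true p q).2.1 < q.1)%R.
Proof.
case: p q => [x1 y1] [x2 y2] /andP[/= h1 h2] /andP[/= h3 h4].
rewrite /dyn /= ltr_pdivrMr; last positivity.
have := mulr_gt0 h1 h3; have := mulr_gt0 h3 h3; lra.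
Qed.

(** * The action of braids on positive configurations *)

Definition config := nat -> rat * rat.
Definition pos_config (c : config) := forall i, pos2 (c i).

Definition dyn_act (c : config) (a : letter) : config := fun i =>
  let r := dyn a.2 (c a.1) (c a.1.+1) in
  if i == a.1 then r.1 else if i == a.1.+1 then r.2 else c i.

Definition dyn_word (c : config) (w : seq letter) : config := foldl dyn_act c w.

Lemma dyn_word_cat c u v : dyn_word c (u ++ v) = dyn_word (dyn_word c u) v.
Proof. exact: foldl_cat. Qed.

Lemma dyn_act_pos c a : pos_config c -> pos_config (dyn_act c a).
Proof.
move=> pc i; have /andP[p1 p2] := dyn_pos a.2 (pc a.1) (pc a.1.+1).
by rewrite /dyn_act; case: eqP => // _; case: eqP.
Qed.

Lemma dyn_word_pos c w : pos_config c -> pos_config (dyn_word c w).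
Proof. by elim: w c => // a w IH c pc; apply/IH/dyn_act_pos. Qed.

Lemma dyn_act_near c k : pos_config c ->
  dyn_word c [:: (k, true); (k.+1, true); (k, true)] =
  dyn_word c [:: (k.+1, true); (k, true); (k.+1, true)].
Proof.
move=> pc; have := dyn_braid (pc k) (pc k.+1) (pc k.+2).
set p := c k; set q := c k.+1; set r := c k.+2 => /= e.
rewrite /dyn_word /=; apply/funext => i; rewrite /dyn_act /= !eqxx.
have -> : (k == k.+1) = false by lia.
have -> : (k.+1 == k) = false by lia.
have -> : (k.+2 == k) = false by lia.
have -> : (k.+2 == k.+1) = false by lia.
have -> : (k == k.+2) = false by lia.
rewrite -/p -/q -/r; case: e => e1 e2 e3.
case: (i =P k) => [->|_].
  have -> : (k == k.+1) = false by lia.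
  have -> : (k == k.+2) = false by lia.
  exact: e1.
case: (i =P k.+1) => [_|_]; first exact: e2.
by case: (i =P k.+2).
Qed.

Lemma dyn_act_far c i j a b : far i j ->
  dyn_act (dyn_act c (i, a)) (j, b) = dyn_act (dyn_act c (j, b)) (i, a).
Proof.
rewrite /far => f; apply/funext => l; rewrite /dyn_act /=.
by repeat (case: eqP => ?); first [done | lia].
Qed.

(** Each defining relation is respected: the positive ones by [dyn_act_near] and [dyn_act_far],
    cancellation by [dynK]. *)
Lemma dyn_word_congr u v : word_congr braid_group_rel u v ->
  forall c, pos_config c -> dyn_word c u = dyn_word c v.
Proof.
elim=> {u v} [a u v b r|//|u v _ h|u v w _ h _ h'] c pc; last 2 first.
- by rewrite h.
- by rewrite h ?h'.
rewrite !dyn_word_cat; congr dyn_word; have := dyn_word_pos a pc.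
move: (dyn_word c a) => {pc}c pc; case: r => {u v} [u v r|k e].
  case: r => i j ij /=; last first.
    have /orP[/eqP->|/eqP->] : (i == j.+1) || (j == i.+1) by lia.
      exact: esym (dyn_act_near j pc).
    exact: dyn_act_near i pc.
  by rewrite /dyn_word /= dyn_act_far // /far; lia.
apply/funext => i; rewrite /dyn_word /= {1}/dyn_act /=.
have := dynK e (pc k) (pc k.+1).
have -> : dyn_act c (k, e) k = (dyn e (c k) (c k.+1)).1.
  by rewrite /dyn_act /= eqxx.
have -> : dyn_act c (k, e) k.+1 = (dyn e (c k) (c k.+1)).2.
  by rewrite /dyn_act /= eqxx; have -> : (k.+1 == k) = false by lia.
move=> ->; case: eqP => [->//|/eqP/negbTE ik]; case: eqP => [->//|/eqP/negbTE ik1].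
by rewrite /dyn_act ik ik1.
Qed.

(** The letter [n] is sigma_(n+1), so main generators appear below as [n.+1]. Leaving open whether
    [(n, true)] occurs makes the class closed under concatenation and lets it contain all words in
    lower letters. *)
Definition nonneg n (w : seq letter) :=
  all (fun a : letter => (a.1 < n) || (a == (n, true))) w.

Lemma nonneg_cat n u v : nonneg n (u ++ v) = nonneg n u && nonneg n v.
Proof. exact: all_cat. Qed.

(** Letters below [n] touch no entry beyond [n], while [(n, true)] decreases the coordinate by
    [dyn_decr]; one occurrence makes the comparison strict. *)
Lemma dyn_word_decr n w c : pos_config c -> nonneg n w ->
  ((dyn_word c w n.+1).1 < (c n.+1).1 ?<= if ((n, true) \notin w))%R.
Proof.
elim: w c => [|a w IH] c pc /=; first by rewrite /= lexx.
case/andP=> an nw; have := IH _ (dyn_act_pos a pc) nw.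
have [->|na] := eqVneq a (n, true); rewrite inE.
  rewrite eqxx /= => /lteifW le; apply: le_lt_trans le _.
  rewrite /dyn_act /= eqxx; have -> : (n.+1 == n) = false by lia.
  exact: dyn_decr.
rewrite eq_sym (negbTE na) /=.
suff -> : dyn_act c a n.+1 = c n.+1 by [].
move: an; rewrite (negbTE na) orbF => an; rewrite /dyn_act.
have -> : (n.+1 == a.1) = false by lia.
by have -> : (n.+1 == a.1.+1) = false by lia.
Qed.

(** A trivial word would fix the coordinate that [dyn_word_decr] shows to decrease. *)
Lemma nonneg_nontrivial n w : nonneg n w -> (n, true) \in w -> braid_of w <> 1%g.
Proof.
move=> nw nin /class_ofP /dyn_word_congr e.
have pc : pos_config (fun=> (1, 1)%R) by [].
have := dyn_word_decr pc nw; rewrite (e _ pc) nin /=.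
by rewrite ltxx.
Qed.

Lemma nonneg_word_main n w : nonneg n w -> word_main w <= n.+1.
Proof.
move=> /allP nw; apply/bigmax_leqP_seq => a /nw /orP[an _|/eqP->] //.
exact: leqW.
Qed.

Lemma nonneg_sigma_positive n w : nonneg n w -> (n, true) \in w ->
  sigma_positive w /\ word_main w = n.+1.
Proof.
move=> nw nin; have e : word_main w = n.+1.
  apply/eqP; rewrite eqn_leq nonneg_word_main //.
  exact: (leq_bigmax_seq (n, true)).
split=> //; rewrite /sigma_positive e; apply/andP; split.
  by apply/hasP; exists (n, true); rewrite //= eqxx.
apply/hasPn => a /(allP nw) /orP[an|/eqP->]; last by rewrite andbF.
by rewrite eqSS (ltn_eqF an).
Qed.

Lemma sigma_positive_nonneg w : sigma_positive w -> exists n,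
  [/\ word_main w = n.+1, nonneg n w & (n, true) \in w].
Proof.
case/andP=> /hasP[[n b] nin /= /andP[/eqP e eb]] /hasPn h.
move: nin; rewrite eb => nin; exists n; split=> //.
apply/allP=> -[k b'] kin; have /= := h _ kin; rewrite -e eqSS => hb.
have : k.+1 <= word_main w by apply: (leq_bigmax_seq (k, b')).
rewrite -e ltnS leq_eqVlt => /orP[/eqP ek|->//].
by move: hb; rewrite ek eqxx /= negbK => ->; rewrite eqxx orbT.
Qed.

(** * Paths in Gamma(z) *)

Lemma braid_of_cat u v : braid_of (u ++ v) = (braid_of u * braid_of v)%g.
Proof. by rewrite [RHS]presented_mulE. Qed.

Lemma braid_of_cons a w : braid_of (a :: w) = (braid_of [:: a] * braid_of w)%g.
Proof. exact: (braid_of_cat [:: a]). Qed.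

Lemma braid_of_flip a : (braid_of [:: a] * braid_of [:: flip a] = 1)%g.
Proof. by rewrite -braid_of_cat; apply/class_ofP/(inv_word_mulr [:: a]). Qed.

Lemma emb_sigma k : emb (psigma k) = braid_of [:: (k, true)].
Proof. exact: emb_of. Qed.

Lemma embM x y : emb (x * y)%g = (emb x * emb y)%g.
Proof. exact: emb_monoid_morphism.2. Qed.

Lemma nonneg_le n n' w : n <= n' -> nonneg n w -> nonneg n' w.
Proof.
move=> nn'; apply: sub_all => -[k b] /orP[/= kn|/eqP[-> ->]].
  by rewrite /= (leq_trans kn).
by move: nn'; rewrite leq_eqVlt => /orP[/eqP->|->//]; rewrite eqxx orbT.
Qed.

Lemma jump_irr r x : ~ jump r x x.
Proof.
case=> w [/sigma_positive_nonneg[n [_ nw nin]] _].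
by rewrite mulVg; exact: nonneg_nontrivial nw nin.
Qed.

Lemma jumpP r x y : jump r x y <-> exists n w,
  [/\ r <= n.+1, nonneg n w, (n, true) \in w & emb y = (emb x * braid_of w)%g].
Proof.
split=> [[w [/sigma_positive_nonneg[n [e nw nin]] rw ew]]|[n [w [rn nw nin ew]]]].
  by exists n, w; rewrite -e ew mulgA mulgV mul1g.
have [sw e] := nonneg_sigma_positive nw nin.
by exists w; rewrite e ew mulgA mulVg mul1g.
Qed.

(** The larger of the two top letters keeps a single sign in the concatenated word. *)
Lemma jump_trans r x y z : jump r x y -> jump r y z -> jump r x z.
Proof.
move=> /jumpP[n [w [rn nw nin ew]]] /jumpP[n' [w' [rn' nw' nin' ew']]].
apply/jumpP; exists (maxn n n'), (w ++ w'); split.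
- by rewrite (leq_trans rn) // ltnS leq_maxl.
- by rewrite nonneg_cat (nonneg_le _ nw) ?leq_maxl // (nonneg_le _ nw') ?leq_maxr.
- by rewrite mem_cat; case: leqP => _; rewrite ?nin ?nin' ?orbT.
- by rewrite braid_of_cat mulgA -ew.
Qed.

(** Vertices are recorded as positive braids, where cancellation and lcms apply; [drawn] locates
    them only through [emb]. *)
Inductive gpath (z : pbraid) : pbraid -> seq letter -> pbraid -> Prop :=
| gpath_nil x of Div z x : gpath z x [::] x
| gpath_pos k x w y of gpath z (x * psigma k)%g w y :
    gpath z x ((k, true) :: w) y
| gpath_neg k x w y of Div z (x * psigma k)%g & gpath z x w y :
    gpath z (x * psigma k)%g ((k, false) :: w) y.

Definition null n (w : seq letter) := all (fun a : letter => a.1 < n) w.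

(** On [Div z] this is an equivalence, while [reach] is a preorder; [null_conn_total] compares by
    [reach z n] any two vertices related by [null_conn z n.+1]. *)
Definition null_conn z n x y := exists2 w, gpath z x w y & null n w.
Definition reach z n x y := exists2 w, gpath z x w y & nonneg n w.

Lemma null_nonneg n w : null n w -> nonneg n w.
Proof. by apply: sub_all => a ->. Qed.

Section Gamma.
Variable z : pbraid.

Lemma Div_mull x t : Div z (x * t)%g -> Div z x.
Proof. by case=> s ->; exists (t * s)%g; rewrite mulgA. Qed.

Lemma gpath_start x w y : gpath z x w y -> Div z x.
Proof. by elim=> // k x' w' y' _ /Div_mull. Qed.

Lemma gpath_cat x u y v t : gpath z x u y -> gpath z y v t -> gpath z x (u ++ v) t.
Proof. by elim=> // *; [apply: gpath_pos|apply: gpath_neg]; auto. Qed.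

Lemma gpath_rev x w y : gpath z x w y -> gpath z y (inv_word w) x.
Proof.
elim=> {x w y} [x xz|k x w y p ip|k x w y xz p ip]; first exact: gpath_nil.
  rewrite /inv_word /= rev_cons -cats1; apply: gpath_cat ip _.
  apply: gpath_neg; first exact: gpath_start p.
  exact/gpath_nil/Div_mull/(gpath_start p).
rewrite /inv_word /= rev_cons -cats1; apply: gpath_cat ip _.
exact/gpath_pos/gpath_nil.
Qed.

Lemma gpath_emb x w y : gpath z x w y -> emb y = (emb x * braid_of w)%g.
Proof.
elim=> {x w y} [x _|k x w y _ ->|k x w y _ _ ->].
- by rewrite mulg1.
- by rewrite braid_of_cons embM emb_sigma mulgA.
- rewrite braid_of_cons embM emb_sigma -mulgA (mulgA (braid_of [:: (k, true)])).
  by rewrite (braid_of_flip (k, true)) mul1g.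
Qed.

Lemma gpath_drawn x w y : gpath z x w y -> drawn z x w.
Proof.
move=> p; split; first exact: gpath_start p.
elim: p => {x w y} [x _|k x w y p ip|k x w y xz p ip] v t k' b.
- by case: v.
- case: v => [[<- <- _]|a v [<- /ip[p' [q [e ee]]]]].
    exists x, (x * psigma k)%g; rewrite mulg1; split=> //; split=> //.
      exact/Div_mull/(gpath_start p).
    exact: gpath_start p.
  by exists p', q; split=> //; rewrite ee embM emb_sigma braid_of_cons mulgA.
- case: v => [[<- <- _]|a v [<- /ip[p' [q [e ee]]]]].
    exists x, (x * psigma k)%g; rewrite mulg1; split=> //; split=> //.
    exact: gpath_start p.
  exists p', q; split=> //; rewrite ee braid_of_cons embM emb_sigma.
  rewrite -mulgA (mulgA (braid_of [:: (k, true)])).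
  by rewrite (braid_of_flip (k, true)) mul1g.
Qed.

Lemma null_rev n w : null n w -> null n (inv_word w).
Proof. by rewrite /inv_word /null all_rev all_map. Qed.

Lemma null_conn_sym n x y : null_conn z n x y -> null_conn z n y x.
Proof.
by case=> w p nw; exists (inv_word w); [apply: gpath_rev|apply: null_rev].
Qed.

Lemma null_conn_trans n x y t :
  null_conn z n x y -> null_conn z n y t -> null_conn z n x t.
Proof.
case=> w p nw [v q nv]; exists (w ++ v); first exact: gpath_cat p q.
by rewrite /null all_cat; apply/andP.
Qed.

Lemma reach_trans n x y t : reach z n x y -> reach z n y t -> reach z n x t.
Proof.
case=> w p nw [v q nv]; exists (w ++ v); first exact: gpath_cat p q.
by rewrite nonneg_cat nw.
Qed.

Lemma null_conn_reach n x y : null_conn z n x y -> reach z n x y.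
Proof. by case=> w p nw; exists w => //; apply: null_nonneg. Qed.

Lemma gpath_pos_word x w : Div z (x * pbraid_of w)%g ->
  gpath z x (pos_word w) (x * pbraid_of w)%g.
Proof.
elim: w x => [|k w IH] x; first by rewrite mulg1; exact: gpath_nil.
by rewrite pbraid_of_cons mulgA => /IH; exact: gpath_pos.
Qed.

Lemma null_conn_mul n x u : main u <= n -> Div z (x * u)%g ->
  null_conn z n x (x * u)%g.
Proof.
rewrite -(pbraid_of_repr u) main_of => mu xu; exists (pos_word (repr u)).
  exact: gpath_pos_word.
apply/allP => _ /mapP[k ku ->] /=; apply: leq_trans mu.
exact: (leq_bigmax_seq k).
Qed.

Lemma reach_mul n x u : main u <= n.+1 -> Div z (x * u)%g -> reach z n x (x * u)%g.
Proof.
rewrite -(pbraid_of_repr u) main_of => mu xu; exists (pos_word (repr u)).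
  exact: gpath_pos_word.
apply/allP => _ /mapP[k ku ->] /=.
have : k < n.+1 by apply: leq_trans mu; apply: (leq_bigmax_seq k).
by rewrite ltnS leq_eqVlt => /orP[/eqP->|->//]; rewrite eqxx orbT.
Qed.

(* Valleys of a path are filled one by one, by taking lcms inside [Div z]. *)
Lemma null_conn_peak n x y : null_conn z n x y -> exists u v,
  [/\ main u <= n, main v <= n, (x * u = y * v)%g & Div z (x * u)%g].
Proof.
case=> w; elim=> {x w y} [x xz _|k x w y p ip|k x w y xz p ip];
  try move=> /andP[/= kn /ip].
- by exists 1%g, 1%g; rewrite mulg1 main1.
- case=> u [v [mu mv e d]]; exists (psigma k * u)%g, v.
  by rewrite mulgA mainM main_sigma geq_max kn mu.
- case=> u [v [mu mv e [t1 d]]]; case: xz => t0 d0.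
  (* Both arms at the valley [x] extend to [z]; cancelling [x] yields a common multiple that
     [pbraid_lcm] factors through a peak inside [Div z]. *)
  have e0 : (psigma k * t0 = u * t1)%g.
    by apply: (@pbraid_mulI x); rewrite !mulgA -d.
  have [|q [r [g [mq mr e1 e2 e3]]]] := pbraid_lcm _ mu e0.
    by rewrite main_sigma.
  exists q, (v * r)%g; rewrite mainM geq_max mv mr; split=> //.
    by rewrite -mulgA e3 !mulgA e.
  by exists g; rewrite -!mulgA -e1 mulgA.
Qed.

(** The cut is at the last letter [(n, true)]: when the tail already has such a cut, it is kept. *)
Lemma reach_split n x y : reach z n x y -> null_conn z n x y \/
  exists q, [/\ reach z n x q, Div z (q * psigma n)%g &
    null_conn z n (q * psigma n)%g y].
Proof.
case=> w; elim=> {x w y} [x xz _|k x w y p ip|k x w y xz p ip];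
  try move=> /andP[/= kn /ip].
- by left; exists [::] => //; apply: gpath_nil.
- case=> [[w' p' nw']|[q [[w' p' nw'] qz nq]]].
    case/orP: kn => [kn|/eqP[kn]].
      by left; exists ((k, true) :: w'); [apply: gpath_pos|rewrite /= kn].
    move: p p'; rewrite kn => p p'; right; exists x; split; last by exists w'.
      exists [::] => //; exact/gpath_nil/Div_mull/(gpath_start p).
    exact: gpath_start p.
  right; exists q; split=> //; exists ((k, true) :: w'); first exact: gpath_pos.
  by rewrite /= kn.
- move: kn; rewrite xpair_eqE andbF orbF => kn.
  case=> [[w' p' nw']|[q [[w' p' nw'] qz nq]]].
    by left; exists ((k, false) :: w'); [apply: gpath_neg|rewrite /= kn].
  right; exists q; split=> //; exists ((k, false) :: w'); first exact: gpath_neg.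
  by rewrite /= kn.
Qed.

(* Handle reduction: each letter sigma_n of the path from [a] to [b] turns into
   [sigma_n^-1 sigma_n.+1 sigma_n], because an element divisible on the right by
   both generators is divisible by their left lcm. *)
Lemma reach_shift n a b b' : reach z n a b -> b = (b' * psigma n.+1)%g ->
  exists2 a', a = (a' * psigma n.+1)%g & reach z n.+1 a' b'.
Proof.
case=> w p; elim: p b' => {a w b}
  [x xz|k x w y p ip|k x w y xz p ip] b' /= nw eb.
- exists b' => //; exists [::] => //; apply/gpath_nil.
  by move: xz; rewrite eb => /Div_mull.
- case/andP: nw => kn /ip /(_ eb) [c /sigma_rcm[t [ex ec]] cb].
  have xz := Div_mull (gpath_start p).
  have cz : Div z c by case: cb => ? /gpath_start.
  case/orP: kn => [kn|/eqP[kn]].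
    have f : far k n.+1 by rewrite /far; lia.
    move: ex ec; rewrite (compl_far f) (compl_far (etrans (farC _ _) f)).
    rewrite !mirror_sigma => ex ec; exists t => //; apply: reach_trans cb.
    exists [:: (k, true)]; last by rewrite /= (leqW kn).
    by apply: gpath_pos; rewrite -ec; apply: gpath_nil.
  have f : near k n.+1 by rewrite /near; lia.
  move: ex ec; rewrite (compl_near f) (compl_near (etrans (nearC _ _) f)).
  rewrite !mirrorM !mirror_sigma !mulgA kn => ex ec; exists (t * psigma n)%g => //.
  apply: reach_trans cb; exists [:: (n, false); (n.+1, true); (n, true)].
    apply: gpath_neg; first by move: xz; rewrite ex => /Div_mull.
    by do 2 apply: gpath_pos; rewrite -ec; apply: gpath_nil.
  by rewrite /= ltnS leqnn eqxx orbT.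
- case/andP: nw; rewrite xpair_eqE andbF orbF => kn /ip /(_ eb) [c ex cb].
  have f : far k n.+1 by rewrite /far; lia.
  have e : (x * psigma k = c * psigma k * psigma n.+1)%g.
    by rewrite ex -!mulgA (sigma_far f).
  exists (c * psigma k)%g => //; apply: reach_trans cb.
  exists [:: (k, false)]; last by rewrite /= (leqW kn).
  apply: gpath_neg; first by move: xz; rewrite e => /Div_mull.
  by apply: gpath_nil; move: (gpath_start p); rewrite ex => /Div_mull.
Qed.

(** * Finiteness of [Div z] and descent on peaks *)

Lemma pbraid_finite N m : exists L : seq pbraid,
  forall x, len x <= N -> main x <= m -> x \in L.
Proof.
elim: N => [|N [L LP]].
  by exists [:: 1%g] => x; rewrite leqn0 => /eqP/len_eq0-> _; rewrite mem_head.
exists (1%g :: [seq (psigma k * x)%g | k <- iota 0 m, x <- L]) => x.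
case: (pbraid_case x) => [->|[k [y ->]]]; first by rewrite mem_head.
rewrite lenM len_sigma mainM main_sigma geq_max => ly /andP[km my].
rewrite inE; apply/orP; right; apply/allpairsP; exists (k, y).
by rewrite mem_iota; split=> //; apply: LP.
Qed.

Lemma Div_finite : exists L : seq pbraid, forall x, Div z x -> x \in L.
Proof.
have [L LP] := pbraid_finite (len z) (main z); exists L => x [t e].
by apply: LP; rewrite e ?lenM ?mainM ?leq_addr ?leq_maxl.
Qed.

Lemma reach_jump n x q y : reach z n x q -> null_conn z n (q * psigma n)%g y ->
  jump n.+1 x y.
Proof.
case=> w p nw [v p' nv]; apply/jumpP; exists n, (w ++ (n, true) :: v).
split=> //; rewrite ?nonneg_cat /= ?nw ?null_nonneg ?eqxx ?orbT //.
  by rewrite mem_cat mem_head orbT.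
by rewrite (gpath_emb (gpath_cat p (gpath_pos p'))).
Qed.

(* A handle at a peak [q] yields a peak with fewer [jump n.+1]-predecessors in
   the finite set [Div z], because [jump n.+1] is acyclic. *)
Lemma null_conn_total_step n :
  (forall q1 q2, null_conn z n (q1 * psigma n)%g (q2 * psigma n)%g ->
     reach z n q1 q2 \/ reach z n q2 q1) ->
  forall x y, null_conn z n.+1 x y -> reach z n x y \/ reach z n y x.
Proof.
move=> handle x y /null_conn_peak[u [v [mu mv e d]]].
have := reach_mul mu d; have : reach z n y (x * u)%g.
  by rewrite e; apply: reach_mul => //; rewrite -e.
move: (x * u)%g => q {u v mu mv e d}.
have [L LP] := Div_finite.
pose h q := count (fun p => `[< jump n.+1 p q >]) L.
have h_lt p p' : Div z p -> jump n.+1 p p' -> h p < h p'.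
  move=> pz pp'; have sub : subpred (fun t => `[< jump n.+1 t p >])
      (fun t => `[< jump n.+1 t p' >]).
    by move=> t /asboolP tp; apply/asboolP/(jump_trans tp).
  (* The list is cut at [p], which is counted by [h p'] but, by irreflexivity, not by [h p]. *)
  rewrite /h -(cat_take_drop (index p L) L) (drop_nth p) ?index_mem ?LP //.
  rewrite !count_cat /= nth_index ?LP // -addnS; apply: leq_add.
    exact: sub_count.
  rewrite (asboolT pp') addSn ltnS.
  case: asboolP => [/jump_irr//|_]; exact: sub_count.
have [N] := ubnP (h q); elim: N q => // N IH q; rewrite ltnS => hq yq xq.
(* A path in lower letters only can be reversed, so in that case [y] reaches [x] through [q]. *)
case: (reach_split xq) => [/null_conn_sym/null_conn_reach qx|[q1 [xq1 q1z nq1]]].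
  by right; apply: reach_trans qx.
case: (reach_split yq) => [/null_conn_sym/null_conn_reach qy|[q2 [yq2 q2z nq2]]].
  by left; apply: reach_trans qy.
have nil_reach p : Div z (p * psigma n)%g -> reach z n p p.
  by move=> /Div_mull d; exists [::] => //; apply: gpath_nil.
have lt1 : h q1 < N.
  apply: leq_trans _ hq; apply: h_lt (Div_mull q1z) _.
  exact: reach_jump (nil_reach _ q1z) nq1.
have lt2 : h q2 < N.
  apply: leq_trans _ hq; apply: h_lt (Div_mull q2z) _.
  exact: reach_jump (nil_reach _ q2z) nq2.
(* One of [q1], [q2] is reached from the other, hence from both [x] and [y]; it is the new peak,
   with smaller [h]. *)
case: (handle q1 q2 (null_conn_trans nq1 (null_conn_sym nq2))) => r.
  by apply: (IH q2) => //; apply: reach_trans r.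
by apply: (IH q1) => //; apply: reach_trans r.
Qed.

(** Induction on [n]: the inductive hypothesis gives the part between two last letters a single sign
    in its own top letter, and [reach_shift] then removes the handle. *)
Lemma null_conn_total n x y : null_conn z n.+1 x y -> reach z n x y \/ reach z n y x.
Proof.
elim: n x y => [|n IHn] x y.
(* With no letters available the path is empty, and the common last generator cancels. *)
- have handle q1 q2 : null_conn z 0 (q1 * psigma 0)%g (q2 * psigma 0)%g ->
      reach z 0 q1 q2 \/ reach z 0 q2 q1.
    case=> -[|//] p _; left; exists [::] => //.
    have d := Div_mull (gpath_start p).
    suff <- : q1 = q2 by apply: gpath_nil.
    by apply: (@sigma_mulIr 0); inversion p.
  exact: null_conn_total_step.
apply: null_conn_total_step => q1 q2 /IHn.
case=> /reach_shift /(_ erefl) [q /sigma_mulIr <-].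
  by left.
by right.
Qed.
End Gamma.

(** * Heights and complexity *)

(** The jump followed by the return path would be a trivial sigma-positive word with top letter
    [n'], since [n <= n']. *)
Lemma reach_jump_false z r n x y : n < r -> jump r x y -> reach z n y x -> False.
Proof.
move=> nr /jumpP[n' [w [rn' nw nin ew]]] [v p nv].
have nn' : n <= n' by rewrite -ltnS (leq_trans nr).
apply: (@nonneg_nontrivial n' (w ++ v)).
- by rewrite nonneg_cat nw (nonneg_le nn').
- by rewrite mem_cat nin.
by apply: (mulgI (emb x)); rewrite braid_of_cat mulgA -ew -(gpath_emb p) mulg1.
Qed.

Lemma Div_null_conn z x y : Div z x -> Div z y -> null_conn z (main z) x y.
Proof.
have top t : Div z t -> null_conn z (main z) t z.
  case=> s e; have : null_conn z (main z) t (t * s)%g.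
    apply: null_conn_mul; first by rewrite e mainM leq_maxr.
    by rewrite -e; exists 1%g; rewrite mulg1.
  by rewrite -e.
by move=> xz yz; apply: null_conn_trans (top _ xz) (null_conn_sym (top _ yz)).
Qed.

(** Totality joins [x] and [y] in one direction. The wrong direction contradicts the jump, and so
    does a path without [(n, true)], which could be reversed. *)
Lemma jump_gpath z n x y : main z = n.+1 -> Div z x -> Div z y -> jump n.+1 x y ->
  exists w, [/\ gpath z x w y, nonneg n w & (n, true) \in w].
Proof.
move=> mz xz yz xy; have := Div_null_conn xz yz; rewrite mz.
case/null_conn_total=> [[w p nw]|/(reach_jump_false _ xy)//]; last first.
  by case.
exists w; split=> //; case: (boolP ((n, true) \in w)) => // nin.
have c : null_conn z n x y.
  exists w => //; apply/allP=> a ain; have /orP[//|/eqP e] := allP nw _ ain.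
  by rewrite -e ain in nin.
by case: (reach_jump_false (ltnSn n) xy (null_conn_reach (null_conn_sym c))).
Qed.

(** Each jump is realised by a path with at least one letter [(n, true)], possibly more, whence only
    an inequality. *)
Lemma chain_gpath z n x s : main z = n.+1 ->
  (forall y, y \in x :: s -> Div z y) ->
  path (fun x y => `[< jump n.+1 x y >]) x s ->
  exists w, [/\ gpath z x w (last x s), nonneg n w &
    size s <= count_mem (n, true) w].
Proof.
move=> mz; elim: s x => [|y s IH] x dz /=.
  by exists [::]; split=> //; apply/gpath_nil/dz; rewrite mem_head.
case/andP=> /asboolP xy ys.
have [|w [p nw cw]] := IH y _ ys.
  by move=> t ts; apply: dz; rewrite inE ts orbT.
have [||v [q nv nin]] := jump_gpath mz _ _ xy.
- by apply: dz; rewrite mem_head.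
- by apply: dz; rewrite !inE eqxx orbT.
exists (v ++ w); rewrite nonneg_cat nv; split=> //; first exact: gpath_cat q p.
by rewrite count_cat -add1n leq_add // -has_count has_pred1.
Qed.

(** * From drawn words to chains *)

Lemma drawn_cons z x k b w : drawn z x ((k, b) :: w) -> exists y,
  [/\ k < main z, emb y = (emb x * braid_of [:: (k, b)])%g & drawn z y w].
Proof.
case=> xz h; have [p [q [[pz qz e] eb]]] := h [::] w k b erefl.
(* The letter is realised by an edge whose departure vertex has the same image as [x] under [emb];
   its other end serves as [y]. *)
rewrite mulg1 in eb; exists (if b then q else p).
have ey : emb (if b then q else p) = (emb x * braid_of [:: (k, b)])%g.
  rewrite -eb; case: {+}b; rewrite e embM emb_sigma //.
  by rewrite -mulgA (braid_of_flip (k, true)) mulg1.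
split=> //.
  case: qz => t ->; rewrite e !mainM main_sigma; lia.
split; first by case: ifP.
move=> v t k' b' ew; have [|p' [q' [e' eb']]] := h ((k, b) :: v) t k' b'.
  by rewrite ew.
by exists p', q'; split=> //; rewrite eb' ey -mulgA -braid_of_cons.
Qed.

Lemma drawn_letters z x w : drawn z x w -> null (main z) w.
Proof.
by elim: w x => // -[k b] w IH x /drawn_cons[y [km _ /IH nw]]; rewrite /= km.
Qed.

(** The list [s] collects the vertices reached just after the letters [(n, true)]. *)
Lemma drawn_chain z n x w : drawn z x w -> nonneg n w -> exists s,
  [/\ forall y, y \in x :: s -> Div z y,
      path (fun x y => `[< jump n.+1 x y >]) x s & size s = count_mem (n, true) w].
Proof.
elim: w x => [|[k b] w IH] x d /=.
  by exists [::]; split=> // y; rewrite inE => /eqP->; case: d.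
have xz := d.1; case/drawn_cons: d => y [_ ey /IH{IH}IH] /andP[kb /IH[s [sz ps ss]]].
case: (eqVneq (k, b) (n, true)) kb => [[kn bt]|_].
  exists (y :: s); split; last by rewrite /= ss.
    by move=> t; rewrite inE => /orP[/eqP->//|/sz].
  rewrite /= ps andbT; apply/asboolP/jumpP; exists n, [:: (k, b)].
  by rewrite kn bt /= eqxx orbT mem_head ey kn bt.
rewrite orbF => kn; case: s sz ps ss => [|y' s] sz ps ss.
  by exists [::]; split=> // t; rewrite inE => /eqP->.
case/andP: ps => /asboolP/jumpP[n' [v [nn' nv nin ev]]] ps.
(* A lower letter only moves the head of the chain from [y] back to [x]: it is put in front of the
   word of the first jump. *)
exists (y' :: s); split=> //.
  by move=> t; rewrite inE => /orP[/eqP->//|ts]; apply: sz; rewrite inE ts orbT.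
apply/andP; split; last exact: ps.
apply/asboolP/jumpP; exists n', ((k, b) :: v).
split=> //; first by rewrite /= (leq_trans kn).
  by rewrite inE nin orbT.
by rewrite ev ey (braid_of_cons _ v) mulgA.
Qed.

(** A chain has no repetitions, since [jump r] is transitive and irreflexive. *)
Lemma chain_bounded z r : exists N, forall n, chain_lengths r z n -> n <= N.
Proof.
have [L LP] := Div_finite z; exists (size L) => n [s [sz srt ->]].
apply: uniq_leq_size => [|x /sz/LP//].
apply: sorted_uniq srt => [x y t /asboolP xy /asboolP yt|x].
  by apply/asboolP; apply: jump_trans xy yt.
by apply/asboolP/jump_irr.
Qed.

Lemma height_exists z r : exists h, is_height r z h.
Proof.
have [N NP] := chain_bounded z r.
have ex : exists n, `[< chain_lengths r z n >].
  by exists 0; apply/asboolP; exists [::].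
have bnd n : `[< chain_lengths r z n >] -> n <= N by move/asboolP/NP.
case: (ex_maxnP ex bnd) => h /asboolP hh hmax; exists h; split=> // j /asboolP.
exact: hmax.
Qed.

Lemma count_main n (w : seq letter) :
  count (fun a : letter => (a.1.+1 == n.+1) && a.2) w = count_mem (n, true) w.
Proof. by apply: eq_count => -[k b]; rewrite /= xpair_eqE eqSS eqb_id. Qed.

Lemma main_jump z n : main z = n.+1 -> jump n.+1 1%g z.
Proof.
move=> mz; apply/jumpP; exists n, (pos_word (repr z)).
have lt k : k \in repr z -> k < n.+1.
  by move=> kz; rewrite -mz; apply: (leq_bigmax_seq k).
split=> //; last first.
- by rewrite (emb_of [::]) [RHS](mul1g (emb z)).
- apply: contra_eqT mz => nin; rewrite neq_ltn ltnS; apply/orP; left.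
  apply/bigmax_leqP_seq => k kz _; have := lt k kz; rewrite ltnS leq_eqVlt.
  case/orP=> // /eqP kn; case/negP: nin; apply/mapP; exists n => //.
  by rewrite -kn.
apply/allP=> _ /mapP[k /lt kn ->] /=.
by move: kn; rewrite ltnS leq_eqVlt => /orP[/eqP->|->//]; rewrite eqxx orbT.
Qed.

Lemma complexity_height (z : pbraid) : z <> 1%g -> exists c h : nat,
  [/\ is_complexity z c, is_height (main z) z h & c = h - 1].
Proof.
move=> z1; case mz: (main z) => [|n]; first by move/main_eq0: mz.
have [h hh] := height_exists z n.+1; exists (h - 1), h; split=> //.
rewrite /is_complexity; case: eqP => // _; rewrite mz.
(* The chain drawn from a word has one element more than it has steps, hence the shift by one. *)
have le j : drawn_counts n.+1 z j -> j.+1 <= h.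
  case=> x [w [sw d ->]]; rewrite count_main.
  (* The main generator of [w] could be lower than that of [z]; [drawn_letters] bounds it from
     above. *)
  have nw : nonneg n w.
    have [k [_ nw kin]] := sigma_positive_nonneg sw.
    by apply: nonneg_le nw; have := drawn_letters d; rewrite mz => /allP/(_ _ kin).
  have [s [sz ps <-]] := drawn_chain d nw.
  by apply: hh.2; exists (x :: s).
(* The chain from 1 to [z] makes [s] below nonempty, so that the path found contains [(n, true)] and
   is sigma-positive. *)
have h2 : 1 < h.
  apply: hh.2; exists [:: 1%g; z]; split=> //=.
    move=> y; rewrite !inE => /orP[]/eqP->; first by exists z; rewrite mul1g.
    by exists 1%g; rewrite mulg1.
  rewrite andbT; apply/asboolP/main_jump; first by rewrite mz.
have [[|x s] [sz srt eh]] := hh.1; first by rewrite eh in h2.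
split; last by move=> j /le; lia.
have [w [p nw cw]] := chain_gpath mz sz srt.
exists x, w; rewrite count_main.
have nin : (n, true) \in w.
  by rewrite -has_pred1 has_count (leq_trans _ cw) // -ltnS -/(size (x :: s)) -eh.
have [sw _] := nonneg_sigma_positive nw nin; have dw := gpath_drawn p.
(* The upper bound [le], applied to this path, turns the lower bound on its count into an
   equality. *)
have /le : drawn_counts n.+1 z (count_mem (n, true) w).
  by exists x, w; rewrite count_main.
rewrite eh ltnS => lt; split=> //.
by apply/eqP; rewrite eqn_leq subn1 cw.
Qed.

(** * Powers of Delta *)

Lemma mainX x d : 0 < d -> main (x ^+ d)%g = main x.
Proof.
by elim: d => // -[|d] IH _; rewrite ?expg1 // expgS mainM IH // maxnn.
Qed.

Lemma main_prod_sigma n : main (\prod_(i < n) psigma i)%g = n.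
Proof.
elim: n => [|n IH]; first by rewrite big_ord0 main1.
by rewrite big_ord_recr /= mainM main_sigma IH; lia.
Qed.

Lemma main_Delta n : main (Delta n) = n.-1.
Proof.
elim: n => [|n IH]; first exact: main1.
by rewrite /= mainM main_prod_sigma IH; lia.
Qed.

Lemma Div1 x : Div 1%g x -> x = 1%g.
Proof. by case=> t /(congr1 len); rewrite len1 lenM => e; apply: len_eq0; lia. Qed.

Lemma height1 r : is_height r 1%g 1.
Proof.
split=> [|_ [[|x [|y s]] [sz srt ->]] //].
  by exists [:: 1%g]; split=> // x; rewrite inE => /eqP->; exists 1%g; rewrite mulg1.
have /Div1 x1 : Div 1%g x by apply: sz; rewrite mem_head.
have /Div1 y1 : Div 1%g y by apply: sz; rewrite !inE eqxx orbT.
by case/andP: srt; rewrite x1 y1 => /asboolP/jump_irr.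
Qed.

Theorem proposition2p19 :
  (forall (z : pbraid) (m : nat), z <> 1%g -> main z = m ->
     exists c h : nat,
       [/\ is_complexity z c, is_height m z h & c = h - 1])
  /\
  (forall n d : nat, 2 <= n ->
     exists c h : nat,
       [/\ is_complexity (Delta n ^+ d)%g c,
           is_height (n - 1) (Delta n ^+ d)%g h & c = h - 1]).
Proof.
split=> [z m z1 <-|n [|d] n2]; first exact: complexity_height.
  (* At [d = 0] the braid is 1: complexity 0 by convention, and the only element of [Div 1] forms
     the longest chain. *)
  by exists 0, 1; split=> //; [rewrite /is_complexity eqxx|exact: height1].
have mD : main (Delta n ^+ d.+1)%g = n - 1 by rewrite mainX // main_Delta subn1.
(* As [n] is at least 2, [main] of the power is positive, so the power is not 1. *)
rewrite -mD; apply: complexity_height => D1; move: mD; rewrite D1 main1; lia.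
Qed.
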